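(* Suppose that Assumption A (stated in the context) holds for the QCQP $(\mathcal{P})$ and that its aggregated sparsity pattern graph $G(\mathcal{V},\mathcal{E})$ is bipartite. Then the SDP relaxation $(\mathcal{P}_R)$ is exact if both of the following hold: (1) $G(\mathcal{V},\mathcal{E})$ is connected; (2) for every $(k,\ell)\in\mathcal{E}$, there is no $y\in\mathbb{R}^m$ satisfying $$y\ge 0,\qquad S(y)\succeq O,\qquad S(y)_{k\ell}\le 0 .$$
   Context: Let $\mathbb{S}^n$ be the space of real symmetric $n\times n$ matrices, $[m]=\{1,\dots,m\}$, $[0,m]=\{0,1,\dots,m\}$, and $A\bullet B=\sum_{i,j}A_{ij}B_{ij}$. Let $Q^0,\dots,Q^m\in\mathbb{S}^n$ and $b\in\mathbb{R}^m$. Consider the QCQP $(\mathcal{P})$: minimize $x^TQ^0x$ over $x\in\mathbb{R}^n$ subject to $x^TQ^px\le b_p$ for $p\in[m]$. Throughout, $(\mathcal{P})$ is assumed to be feasible. Its SDP relaxation $(\mathcal{P}_R)$ is: minimize $Q^0\bullet X$ over $X\in\mathbb{S}^n$ subject to $Q^p\bullet X\le b_p$ for $p\in[m]$, $X\succeq O$ (positive semidefinite). The dual $(\mathcal{D}_R)$ is: maximize $-b^Ty$ over $y\in\mathbb{R}^m$ subject to $y\ge 0$ and $S(y):=Q^0+\sum_{p=1}^m y_pQ^p\succeq O$. The SDP relaxation is called exact if $(\mathcal{P}_R)$ has an optimal solution of rank at most $1$. The aggregated sparsity pattern graph of $(\mathcal{P})$ is the undirected graph $G(\mathcal{V},\mathcal{E})$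 with $\mathcal{V}=[n]$ and $\mathcal{E}=\{(i,j): i\ne j,\ Q^p_{ij}\neq 0\text{ for some }p\in[0,m]\}$. Assumption A: (i) the sets of optimal solutions of $(\mathcal{P}_R)$ and of $(\mathcal{D}_R)$ are both nonempty; and (ii) at least one of the following holds: (a) the feasible set of $(\mathcal{P}_R)$ is bounded; or (b) the set of optimal solutions of $(\mathcal{D}_R)$ is bounded. *)

(* Defs.v *)
From HB Require Import structures.
From mathcomp Require Import all_boot all_order all_algebra.
From mathcomp Require Import all_classical all_reals all_analysis.

Set Implicit Arguments.
Unset Strict Implicit.
Unset Printing Implicit Defensive.

Import Order.TTheory GRing.Theory Num.Theory.
Import numFieldNormedType.Exports.
Local Open Scope classical_set_scope.
Local Open Scope ring_scope.

Definition mxinner (R : realType) (n : nat) (A B : 'M[R]_n) : R :=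
  \sum_i \sum_j A i j * B i j.

Definition quad (R : realType) (n : nat) (A : 'M[R]_n) (x : 'cV[R]_n) : R :=
  (x^T *m A *m x) 0 0.

(* Symmetry is part of positive semidefiniteness: over the reals it is not
   implied by nonnegativity of the quadratic form. *)
Definition psdmx (R : realType) (n : nat) (A : 'M[R]_n) : Prop :=
  A \is symmetricmx /\ forall x : 'cV[R]_n, 0 <= quad A x.

Definition nonneg_vec (R : realType) (m : nat) (y : 'cV[R]_m) : Prop :=
  forall p, 0 <= y p 0.

Definition minimizers (R : realType) (T : Type) (F : set T) (f : T -> R) :
  set T := [set x | F x /\ forall z, F z -> f x <= f z].

Definition maximizers (R : realType) (T : Type) (F : set T) (f : T -> R) :
  set T := [set x | F x /\ forall z, F z -> f z <= f x].

Definition bipartite (T : finType) (e : rel T) : Prop :=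
  exists U : {set T}, forall i j, e i j -> (i \in U) != (j \in U).

Definition graph_connected (T : finType) (e : rel T) : Prop :=
  forall i j, connect e i j.

(* The matrices Q^0, ..., Q^m form one family indexed by ['I_m.+1]: [Q ord0] is
   the objective Q^0, and for [p : 'I_m] (counted from 0) [Q (lift ord0 p)] is
   the matrix of the constraint with bound [b p 0], i.e. Q^(p+1) with b_(p+1). *)
Definition qcqp_feasible (R : realType) (n m : nat)
    (Q : 'I_m.+1 -> 'M[R]_n) (b : 'cV[R]_m) : set 'cV[R]_n :=
  [set x | forall p : 'I_m, quad (Q (lift ord0 p)) x <= b p 0].

Definition sdp_feasible (R : realType) (n m : nat)
    (Q : 'I_m.+1 -> 'M[R]_n) (b : 'cV[R]_m) : set 'M[R]_n :=
  [set X | (forall p : 'I_m, mxinner (Q (lift ord0 p)) X <= b p 0) /\ psdmx X].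

Definition sdp_optimal (R : realType) (n m : nat)
    (Q : 'I_m.+1 -> 'M[R]_n) (b : 'cV[R]_m) : set 'M[R]_n :=
  minimizers (sdp_feasible Q b) (mxinner (Q ord0)).

Definition dual_slack (R : realType) (n m : nat)
    (Q : 'I_m.+1 -> 'M[R]_n) (y : 'cV[R]_m) : 'M[R]_n :=
  Q ord0 + \sum_(p < m) y p 0 *: Q (lift ord0 p).

Definition dual_feasible (R : realType) (n m : nat)
    (Q : 'I_m.+1 -> 'M[R]_n) : set 'cV[R]_m :=
  [set y | nonneg_vec y /\ psdmx (dual_slack Q y)].

Definition dual_optimal (R : realType) (n m : nat)
    (Q : 'I_m.+1 -> 'M[R]_n) (b : 'cV[R]_m) : set 'cV[R]_m :=
  maximizers (dual_feasible Q) (fun y => - (b^T *m y) 0 0).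

Definition sdp_exact (R : realType) (n m : nat)
    (Q : 'I_m.+1 -> 'M[R]_n) (b : 'cV[R]_m) : Prop :=
  exists X, sdp_optimal Q b X /\ (\rank X <= 1)%N.

Definition sparsity_graph (R : realType) (n m : nat)
    (Q : 'I_m.+1 -> 'M[R]_n) : rel 'I_n :=
  fun i j => (i != j) && [exists p, Q p i j != 0].

Definition assumptionA (R : realType) (n m : nat)
    (Q : 'I_m.+1 -> 'M[R]_n) (b : 'cV[R]_m) : Prop :=
  (sdp_optimal Q b !=set0 /\ dual_optimal Q b !=set0) /\
  (bounded_set (sdp_feasible Q b) \/ bounded_set (dual_optimal Q b)).

(* Main.v *)
(* Optimal solutions X of the relaxation and y of its dual have equal values,
   so S(y) . X <= 0. Let sigma be the signs +1/-1 of the bipartition and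
   v_i = sigma_i sqrt(X_ii). Since S(y)_ij > 0 on edges, where v_i v_j =
   - sqrt(X_ii X_jj) <= X_ij, we get S(y) . X >= v^T S(y) v >= 0. Hence equality
   holds entrywise: v v^T agrees with X on the diagonal and on every edge, has
   the same objective and constraint values, and is a rank-one optimal solution.

   The absence of a duality gap comes from a Farkas lemma for a closed convex
   cone K and finitely many linear inequalities l_i x <= beta_i without common
   nonzero recession direction in K; the boundedness in Assumption A provides
   this condition, on the primal or on the dual side. The lemma itself follows
   from first-order optimality of a minimizer over K of the coercive function
   sum_i max(0, l_i x - beta_i)^2. *)
Require Import Defs.
From HB Require Import structures.
From mathcomp Require Import all_boot all_order all_algebra.
From mathcomp Require Import all_classical all_reals all_analysis.
From mathcomp Require Import ring lra.
Import Order.TTheory GRing.Theory Num.Theory.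
Import numFieldNormedType.Exports.
Local Open Scope classical_set_scope.
Local Open Scope ring_scope.

(** * Continuity of linear forms, closed half-spaces, recession directions *)

Lemma scalar_rV_continuous (R : realType) (N : nat) (f : 'rV[R]_N -> R) :
  scalar f -> continuous f.
Proof.
move=> f_lin.
pose fL : {scalar 'rV[R]_N} :=
  HB.pack f (GRing.isLinear.Build _ _ _ _ f f_lin).
have fE x : f x = \sum_j x 0 j * f (delta_mx 0 j).
  rewrite {1}(row_sum_delta x) -[f _]/(fL _) linear_sum.
  by apply: eq_bigr => j _; rewrite linearZ.
rewrite (_ : f = fun x => \sum_j x 0 j * f (delta_mx 0 j)); last exact/funext.
apply: continuous_big => [|j _ x]; first exact: add_continuous.
apply: (@continuousM _ _ (fun x : 'rV[R]_N => x 0 j) (fun=> f (delta_mx 0 j))).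
  exact: coord_continuous.
exact: cst_continuous.
Qed.

Lemma closed_scalar_ge0 (R : realType) (N : nat) (f : 'rV[R]_N -> R) :
  scalar f -> closed [set x | 0 <= f x].
Proof.
move=> /scalar_rV_continuous f_cont.
apply: (@preimage_closed _ _ f [set t | 0 <= t]); last exact: closed_ge.
by move=> x _; exact: f_cont.
Qed.

(** Far enough along a ray with nonzero direction, every norm bound is exceeded. This turns the
    boundedness in Assumption A into the hypothesis [l_pointed] below. *)
Lemma bounded_ray (R : realType) (V : normedModType R) (A : set V) (x d : V) :
  bounded_set A -> (forall s : R, 0 <= s -> A (x + s *: d)) -> d = 0.
Proof.
move=> /pinfty_ex_gt0[M M_gt0 AM] Ad.
apply/eqP; rewrite -normr_le0 leNgt; apply/negP => d_gt0.
pose s := (M + `|x| + 1) / `|d|.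
have s_ge0 : 0 <= s by rewrite divr_ge0 // !addr_ge0 // ltW.
have /AM /= le_M := Ad s s_ge0.
have : `|s *: d| = M + `|x| + 1.
  by rewrite normrZ ger0_norm // divfK // gt_eqF.
have := ler_normB (x + s *: d) x.
rewrite {1}[x + _]addrC addrK => ? ?; lra.
Qed.

(** * A Farkas lemma over a closed convex cone *)

Section Farkas.
Variables (R : realType) (N : nat) (I : finType).
Variables (K : set 'rV[R]_N) (l : I -> 'rV[R]_N -> R) (beta : I -> R).
Hypotheses (K_closed : closed K) (K0 : K 0).
Hypothesis KD : forall x y, K x -> K y -> K (x + y).
Hypothesis KZ : forall (s : R) x, 0 <= s -> K x -> K (s *: x).
Hypothesis l_lin : forall i, scalar (l i).
Hypothesis l_pointed : forall x, K x -> (forall i, l i x <= 0) -> x = 0.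
Hypothesis l_infeasible : ~ exists2 x, K x & forall i, l i x <= beta i.

Let pos (t : R) := Num.max 0 t.
Let penalty x := \sum_i pos (l i x - beta i) ^+ 2.

Let pos_ge0 t : 0 <= pos t. Proof. by rewrite le_max lexx. Qed.

Let pos_ge t : t <= pos t. Proof. by rewrite le_max lexx orbT. Qed.

Let l0 i : l i 0 = 0.
Proof. by have := l_lin i (-1) 0 0; rewrite scaler0 addr0; lra. Qed.

Let lZ i s x : l i (s *: x) = s * l i x.
Proof. by rewrite -[s *: x]addr0 l_lin l0 addr0. Qed.

Let pos_continuous (c : R) i : continuous (fun x => pos (l i x - c)).
Proof.
move=> x; apply: (@continuous_max _ _ (fun=> 0) (fun x => l i x - c)).
  exact: cst_continuous.
apply: (@continuousB _ _ _ (l i) (fun=> c)); last exact: cst_continuous.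
exact: scalar_rV_continuous.
Qed.

(** The sum is continuous and, by [l_pointed], positive on the compact set of unit vectors of [K],
    so it has a positive minimum [c] there; positive homogeneity extends the bound to all of [K]. *)
Let coercive : exists2 c : R, 0 < c &
  forall x, K x -> c * `|x| <= \sum_i pos (l i x).
Proof.
pose S := K `&` [set x | `|x| = 1].
(* Without unit vectors [K] is [{0}], and any constant works. *)
have [[x0 Sx0]|S_empty] := pselect (S !=set0); last first.
  exists 1 => // x Kx; have [->|x_neq0] := eqVneq x 0.
    by rewrite normr0 mulr0; exact: sumr_ge0.
  exfalso; apply: S_empty; exists (`|x|^-1 *: x); split; first exact: KZ.
  by rewrite /= normrZ ger0_norm ?invr_ge0 // mulVf // normr_eq0.
have S_compact : compact S.
  apply: bounded_closed_compact.
    exists 1; split; first exact: num_real.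
    by move=> M M_gt1 x [_ /= ->]; exact: ltW.
  apply: closedI => //.
  apply: (@preimage_closed _ _ (fun x : 'rV[R]_N => `|x|) [set t | t = 1]).
    by move=> x _; exact: norm_continuous.
  exact: closed_eq.
pose g x := \sum_i pos (l i x).
have g_cont : continuous g.
  apply: continuous_big => [|i _]; first exact: add_continuous.
  have -> : (fun x => pos (l i x)) = (fun x => pos (l i x - 0)).
    by apply/funext => y; rewrite subr0.
  exact: pos_continuous.
have [c /[!inE] -[Kc c1] c_min] := EVT_min_rV (ex_intro _ x0 Sx0) S_compact
  (continuous_subspaceT g_cont).
exists (g c).
  rewrite lt_neqAle sumr_ge0 // andbT; apply/eqP => /esym/eqP.
  rewrite psumr_eq0 // => /allP gc0.
  move: c1; rewrite /= (l_pointed _ Kc) ?normr0; last first.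
    move=> i; apply: le_trans (pos_ge _) _.
    by have /eqP -> := gc0 i (mem_index_enum i).
  by move/esym/eqP; rewrite oner_eq0.
move=> x Kx; have [->|x_neq0] := eqVneq x 0.
  by rewrite normr0 mulr0; exact: sumr_ge0.
have nx_gt0 : 0 < `|x| by rewrite normr_gt0.
have : g c <= g (`|x|^-1 *: x).
  apply: c_min; rewrite inE; split; first exact: KZ.
  by rewrite /= normrZ ger0_norm ?invr_ge0 // mulVf // normr_eq0.
rewrite -ler_pdivlMr // => /le_trans; apply.
rewrite /g mulr_suml le_eqVlt; apply/orP; left; apply/eqP.
apply: eq_bigr => i _.
by rewrite lZ mulrC /pos maxr_pMl ?invr_ge0 // mul0r.
Qed.

(** By coercivity the sublevel set of [penalty] at [penalty 0] is compact in [K], and it contains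
    0. *)
Let minimizer : exists2 x, K x & forall z, K z -> penalty x <= penalty z.
Proof.
have penalty_cont : continuous penalty.
  apply: continuous_big => [|i _ x]; first exact: add_continuous.
  by apply: (@continuousM _ _ (fun x => pos (l i x - beta i))
    (fun x => pos (l i x - beta i))); exact: pos_continuous.
have [c c_gt0 c_coer] := coercive.
pose A := K `&` [set x | penalty x <= penalty 0].
have penalty_ge0 x : 0 <= penalty x by apply: sumr_ge0 => i _; exact: sqr_ge0.
have A_compact : compact A.
  apply: bounded_closed_compact; last first.
    apply: closedI => //.
    apply: (@preimage_closed _ _ penalty [set t | t <= penalty 0]).
      by move=> x _; exact: penalty_cont.
    exact: closed_le.
  (* On [A] each positive part p satisfies p^2 <= [penalty 0], hence p <= [penalty 0 + 1]; adding
     [|beta i|] bounds [pos (l i x)]. *)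
  exists ((\sum_i (penalty 0 + 1 + `|beta i|)) / c); split.
    exact: num_real.
  move=> M /ltW le_M x [Kx /= px]; apply: le_trans le_M.
  rewrite ler_pdivlMr // mulrC; apply: le_trans (c_coer _ Kx) _.
  apply: ler_sum => i _.
  have le1 : pos (l i x - beta i) ^+ 2 <= penalty 0.
    apply: le_trans px; rewrite /penalty (bigD1 i) //= lerDl.
    by apply: sumr_ge0 => j _; exact: sqr_ge0.
  have le2 : pos (l i x - beta i) <= penalty 0 + 1.
    by move: (sqr_ge0 (pos (l i x - beta i) - 1)) le1 (pos_ge0 (l i x - beta i));
      nra.
  rewrite {1}/pos ge_max; apply/andP; split.
    by rewrite !addr_ge0.
  move: le2 (pos_ge (l i x - beta i)) (ler_norm (beta i)); lra.
have A0 : A 0 by split => /=.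
have [x /[!inE] -[Kx px] x_min] := EVT_min_rV (ex_intro _ 0 A0) A_compact
  (continuous_subspaceT penalty_cont).
exists x => // z Kz; have [zA|/ltW] := leP (penalty z) (penalty 0).
  by apply: x_min; rewrite inE.
exact: le_trans.
Qed.

(** The square of the positive part has derivative [2 * pos u], which is 2-Lipschitz; this quadratic
    bound replaces differentiation. *)
Let pos_sqr_le (u h : R) :
  pos (u + h) ^+ 2 <= pos u ^+ 2 + 2 * pos u * h + h ^+ 2.
Proof.
by rewrite /pos; case: (leP 0 (u + h)); case: (leP 0 u) => *; nra.
Qed.

(** The sum is half the directional derivative of [penalty] at [x] along [z]; were it negative, a
    short step along [z] inside [K] would lower the penalty. *)
Let first_order x z : K x -> (forall y, K y -> penalty x <= penalty y) ->
  (forall s, 0 < s -> s <= 1 -> K (x + s *: z)) ->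
  0 <= \sum_i pos (l i x - beta i) * l i z.
Proof.
move=> Kx x_min Kxz; set D := \sum_i _.
pose C := \sum_i l i z ^+ 2.
have C_ge0 : 0 <= C by apply: sumr_ge0 => i _; exact: sqr_ge0.
have ineq s : 0 < s -> s <= 1 -> 0 <= 2 * D + s * C.
  move=> s_gt0 s_le; have := x_min _ (Kxz s s_gt0 s_le) => le_p.
  have : penalty (x + s *: z) <= penalty x + s * (2 * D + s * C).
    have -> : penalty x + s * (2 * D + s * C) = \sum_i
        (pos (l i x - beta i) ^+ 2 + 2 * pos (l i x - beta i) * (s * l i z)
          + (s * l i z) ^+ 2).
      rewrite !big_split /= /penalty -addrA; congr (_ + _).
      rewrite mulrDr /D /C !mulr_sumr; congr (_ + _).
        by apply: eq_bigr => i _; ring.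
      by apply: eq_bigr => i _; ring.
    apply: ler_sum => i _.
    rewrite [x + _]addrC l_lin addrAC -addrA addrC [- _ + _]addrC.
    exact: pos_sqr_le.
  by move: le_p s_gt0; nra.
rewrite leNgt; apply/negP => D_lt0.
(* This step gives [s * C <= - D], so [2 * D + s * C <= D < 0]. *)
pose s := Num.min 1 (- D / (C + 1)).
have s_gt0 : 0 < s by rewrite lt_min ltr01 divr_gt0 //; lra.
have := ineq s s_gt0; rewrite ge_min lexx => /(_ isT).
have : s * (C + 1) <= - D.
  by rewrite -ler_pdivlMr ?ge_min ?lexx ?orbT //; lra.
nra.
Qed.

(* The multipliers are the positive parts of the residuals at a minimizer of
   the penalty. *)
Lemma cone_farkas : exists lam : I -> R, [/\ forall i, 0 <= lam i,
  forall x, K x -> 0 <= \sum_i lam i * l i x & \sum_i lam i * beta i < 0].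
Proof.
have [x Kx x_min] := minimizer.
exists (fun i => pos (l i x - beta i)); split => // [z Kz|].
  apply: (@first_order x z) => // s s_gt0 _.
  by apply: KD => //; apply: KZ => //; exact: ltW.
(* The direction [- x] is admissible because steps of length at most 1 only shrink [x]. It yields
   that the multipliers' combination of the [l i x] is at most 0. *)
have : 0 <= \sum_i pos (l i x - beta i) * l i (- x).
  apply: (@first_order x (- x)) => // s s_gt0 s_le1.
  rewrite (_ : x + _ = (1 - s) *: x); last by rewrite scalerBl scale1r scalerN.
  by apply: KZ => //; rewrite subr_ge0.
have penalty_gt0 : 0 < penalty x.
  rewrite lt_neqAle sumr_ge0 ?andbT; last by move=> i _; exact: sqr_ge0.
  apply/eqP => /esym/eqP; rewrite psumr_eq0; last by move=> i _; exact: sqr_ge0.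
  move=> /allP p0; apply: l_infeasible; exists x => // i.
  have := p0 i (mem_index_enum i); rewrite /= sqrf_eq0 => /eqP pi0.
  by have := pos_ge (l i x - beta i); rewrite pi0; lra.
(* This identity sums [pos t ^+ 2 = pos t * t] over the residuals. *)
suff : penalty x = - \sum_i pos (l i x - beta i) * l i (- x)
                   - \sum_i pos (l i x - beta i) * beta i by lra.
rewrite -!sumrN -big_split; apply: eq_bigr => i _ /=.
rewrite -[- x]scaleN1r lZ /pos; case: (leP 0 (l i x - beta i)) => _; ring.
Qed.

End Farkas.

(** * The trace inner product and positive semidefinite matrices *)

Section MatrixForms.
Variables (R : realType) (n : nat).
Implicit Types (A B X : 'M[R]_n) (x v : 'cV[R]_n).

Lemma symmetricmxP A : A \is symmetricmx <-> forall i j, A i j = A j i.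
Proof.
split=> [/is_hermitianmxP A_sym i j|A_sym].
  by rewrite {1}A_sym expr0 scale1r !mxE.
by apply/is_hermitianmxP/matrixP => i j; rewrite expr0 scale1r !mxE.
Qed.

Lemma mxinnerC A B : mxinner A B = mxinner B A.
Proof.
by apply: eq_bigr => i _; apply: eq_bigr => j _; rewrite mulrC.
Qed.

Lemma mxinner_scalar A : scalar (mxinner A).
Proof.
move=> a B X; rewrite /mxinner mulr_sumr -big_split; apply: eq_bigr => i _ /=.
rewrite mulr_sumr -big_split; apply: eq_bigr => j _ /=.
by rewrite !mxE; ring.
Qed.

HB.instance Definition _ A :=
  GRing.isLinear.Build R 'M[R]_n R *%R (mxinner A) (mxinner_scalar A).

Lemma mxinner_trmxr A B : A \is symmetricmx -> mxinner A B^T = mxinner A B.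
Proof.
move=> /symmetricmxP A_sym; rewrite /mxinner exchange_big.
by apply: eq_bigr => i _; apply: eq_bigr => j _; rewrite mxE A_sym.
Qed.

Lemma mxinner_outer A x : mxinner A (x *m x^T) = quad A x.
Proof.
rewrite /quad mxE /mxinner exchange_big; apply: eq_bigr => j _.
rewrite mxE mulr_suml; apply: eq_bigr => i _.
by rewrite !mxE big_ord1 !mxE; ring.
Qed.

Lemma quad_scalar x : scalar (quad (n := n) ^~ x).
Proof.
move=> a A B; rewrite -!mxinner_outer mxinnerC linearP /=.
by rewrite !(mxinnerC (x *m _)).
Qed.

Lemma quad0 x : quad 0 x = 0.
Proof. by rewrite /quad mulmx0 mul0mx mxE. Qed.

Lemma psdmx0 : psdmx (0 : 'M[R]_n).
Proof.
split=> [|x]; last by rewrite quad0.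
by apply/symmetricmxP => i j; rewrite !mxE.
Qed.

Lemma psdmxZ (a : R) A : 0 <= a -> psdmx A -> psdmx (a *: A).
Proof.
move=> a_ge0 [/symmetricmxP A_sym A_ge0]; split=> [|x].
  by apply/symmetricmxP => i j; rewrite !mxE A_sym.
by rewrite -[a *: A]addr0 quad_scalar quad0 addr0 mulr_ge0.
Qed.

Lemma psdmxD A B : psdmx A -> psdmx B -> psdmx (A + B).
Proof.
move=> [/symmetricmxP A_sym A_ge0] [/symmetricmxP B_sym B_ge0]; split=> [|x].
  by apply/symmetricmxP => i j; rewrite !mxE A_sym B_sym.
by rewrite -[A]scale1r quad_scalar mul1r addr_ge0.
Qed.

Lemma psdmx_outer x : psdmx (x *m x^T).
Proof.
split=> [|v].
  by apply/symmetricmxP => i j; rewrite !mxE !big_ord1 !mxE mulrC.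
rewrite -mxinner_outer mxinnerC mxinner_outer.
rewrite (_ : quad _ x = (x^T *m v) 0 0 ^+ 2) ?sqr_ge0 //.
rewrite /quad mulmxA -mulmxA mxE big_ord1 expr2; congr (_ * _).
by rewrite -[v^T *m x]trmxK trmx_mul trmxK [LHS]mxE.
Qed.

(** Symmetry, as inequalities over ordered index pairs, and nonnegativity of the form at each vector
    all define closed half-spaces. The map [f] reads the matrix off the row vectors used in the
    Farkas lemma. *)
Lemma closed_psdmx_linear (N : nat) (f : 'rV[R]_N -> 'M[R]_n) :
  linear f -> closed [set u | psdmx (f u)].
Proof.
move=> f_lin; rewrite (_ : [set u | _] =
    (\bigcap_(ij in [set: 'I_n * 'I_n])
       [set u | 0 <= f u ij.1 ij.2 - f u ij.2 ij.1])
  `&` (\bigcap_(x in [set: 'cV[R]_n]) [set u | 0 <= quad (f u) x])).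
  apply: closedI.
    apply: closed_bigI => -[i j] _; apply: closed_scalar_ge0 => a u v /=.
    by rewrite f_lin !mxE; ring.
  apply: closed_bigI => x _; apply: closed_scalar_ge0 => a u v /=.
  by rewrite f_lin quad_scalar.
apply/seteqP; split => u /= [].
  by move=> /symmetricmxP u_sym u_ge0; split=> [[i j]|x] _ //=; rewrite u_sym subrr.
move=> u_sym u_ge0; split=> [|x]; last exact: u_ge0.
apply/symmetricmxP => i j; apply/eqP; rewrite eq_le; apply/andP.
by split; rewrite -subr_ge0; [exact: (u_sym (j, i)) | exact: (u_sym (i, j))].
Qed.

Lemma quad_delta2 A (i j : 'I_n) (s t : R) :
  quad A (s *: delta_mx i 0 + t *: delta_mx j 0) =
  s ^+ 2 * A i i + s * t * A i j + t * s * A j i + t ^+ 2 * A j j.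
Proof.
have E (k l : 'I_n) :
    delta_mx (0 : 'I_1) k *m A *m delta_mx l (0 : 'I_1) = (A k l)%:M.
  by rewrite -colE -rowE [LHS]mx11_scalar !mxE.
rewrite /quad; have -> : (s *: delta_mx i 0 + t *: delta_mx j 0 : 'cV[R]_n)^T
    = s *: delta_mx 0 i + t *: delta_mx 0 j.
  by rewrite linearD /= !linearZ /= !trmx_delta.
rewrite !mulmxDr !mulmxDl -!scalemxAr -!scalemxAl !E !mxE !mulr1n.
ring.
Qed.

Lemma psdmx_diag_ge0 X i : psdmx X -> 0 <= X i i.
Proof.
move=> [_ /(_ (1 *: delta_mx i 0 + 0 *: delta_mx i 0))].
by rewrite quad_delta2; nra.
Qed.

(** This is one side of the 2x2 principal minor inequality, obtained by testing the form on
    combinations of two basis vectors. *)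
Lemma psdmx_offdiag_ge X i j : psdmx X ->
  - (Num.sqrt (X i i) * Num.sqrt (X j j)) <= X i j.
Proof.
move=> X_psd; have Xi := psdmx_diag_ge0 _ i X_psd.
have Xj := psdmx_diag_ge0 _ j X_psd.
have [/symmetricmxP X_sym X_ge0] := X_psd.
have {}X_ge0 s t : 0 <= s ^+ 2 * Num.sqrt (X i i) ^+ 2
    + 2 * (s * t) * X i j + t ^+ 2 * Num.sqrt (X j j) ^+ 2.
  rewrite !sqr_sqrtr //.
  have := X_ge0 (s *: delta_mx i 0 + t *: delta_mx j 0).
  rewrite quad_delta2 (X_sym j i); lra.
have := sqrtr_ge0 (X i i); have := sqrtr_ge0 (X j j).
move: (Num.sqrt (X i i)) (Num.sqrt (X j j)) (X i j) X_ge0 => a c z X_ge0.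
(* If a diagonal entry vanishes, the chosen coefficients give the form a negative value unless [z]
   is 0. If both are positive, the coefficients [c], [a] give the value
   [2 * (a * c) * (a * c + z)]. *)
rewrite le_eqVlt => /predU1P[c0 _|c_gt0].
  have := X_ge0 (- z) (a ^+ 2 + 1); have := sqr_ge0 z; have := sqr_ge0 (a * z).
  rewrite -c0 => *; rewrite mulr0 oppr0 leNgt; apply/negP => z_lt0.
  by have : 0 < z * z; [rewrite nmulr_rgt0 | lra].
rewrite le_eqVlt => /predU1P[a0|a_gt0].
  have := X_ge0 (c ^+ 2 + 1) (- z); have := sqr_ge0 z; have := sqr_ge0 (c * z).
  rewrite -a0 => *; rewrite mul0r oppr0 leNgt; apply/negP => z_lt0.
  by have : 0 < z * z; [rewrite nmulr_rgt0 | lra].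
have ac_gt0 : 0 < a * c by rewrite mulr_gt0.
rewrite -(ler_pM2l ac_gt0); have := X_ge0 c a; lra.
Qed.

(** The comparison with the signed square roots of the diagonal of [X] stops at the edges: elsewhere
    [S] vanishes and carries no information on [X]. *)
Lemma bipartite_rank_one (e : rel 'I_n) (U : {set 'I_n}) (S X : 'M[R]_n) :
  psdmx S -> psdmx X -> mxinner S X <= 0 ->
  (forall i j, e i j -> (i \in U) != (j \in U)) ->
  (forall i j, e i j -> 0 < S i j) ->
  (forall i j, i != j -> ~~ e i j -> S i j = 0) ->
  exists v : 'cV[R]_n, forall i j, (i == j) || e i j -> X i j = v i 0 * v j 0.
Proof.
move=> [_ S_ge0] X_psd SX_le0 eU S_gt0 S_eq0.
pose v := \col_i ((-1) ^+ (i \in U) * Num.sqrt (X i i)).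
have v_diag i : X i i = v i 0 * v i 0.
  by rewrite !mxE mulrACA -expr2 sqrr_sign mul1r -expr2 sqr_sqrtr //;
     exact: psdmx_diag_ge0.
have v_edge i j : e i j -> v i 0 * v j 0 <= X i j.
  move=> /eU; rewrite !mxE mulrACA.
  case: (i \in U); case: (j \in U) => // _;
    rewrite ?(expr0, expr1, mul1r, mulr1, mulN1r); exact: psdmx_offdiag_ge.
(* These terms are nonnegative and sum to [mxinner S X - quad S v <= 0], so each is 0. *)
pose d (ij : 'I_n * 'I_n) := S ij.1 ij.2 * (X ij.1 ij.2 - v ij.1 0 * v ij.2 0).
have d_ge0 ij : 0 <= d ij.
  case: ij => i j; rewrite /d /=.
  have [->|ij] := eqVneq i j; first by rewrite v_diag subrr mulr0.
  have [eij|eij] := boolP (e i j); last by rewrite S_eq0 // mul0r.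
  by rewrite mulr_ge0 ?subr_ge0 ?v_edge // ltW // S_gt0.
have d_sum : \sum_ij d ij = mxinner S X - quad S v.
  rewrite -mxinner_outer -linearB /= /mxinner pair_bigA.
  by apply: eq_bigr => -[i j] _; rewrite /d !mxE big_ord1 !mxE.
have /eqP : \sum_ij d ij = 0.
  apply/eqP; rewrite eq_le sumr_ge0 // andbT d_sum.
  by have := S_ge0 v; lra.
rewrite psumr_eq0 // => /allP d0; exists v => i j /orP[/eqP <-|eij] //.
have := d0 (i, j) (mem_index_enum _); rewrite /d /= mulf_eq0 gt_eqF ?S_gt0 //=.
by rewrite subr_eq0 => /eqP.
Qed.

End MatrixForms.

(** * Absence of a duality gap under either boundedness condition *)

Section Duality.
Variables (R : realType) (n m : nat) (Q : 'I_m.+1 -> 'M[R]_n) (b : 'cV[R]_m).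
Hypothesis Q_sym : forall p, Q p \is symmetricmx.

Lemma mxinner_dual_slack (y : 'cV[R]_m) (X : 'M[R]_n) :
  mxinner (dual_slack Q y) X =
  mxinner (Q ord0) X + \sum_(p < m) y p 0 * mxinner (Q (lift ord0 p)) X.
Proof.
rewrite mxinnerC linearD linear_sum /= mxinnerC; congr (_ + _).
by apply: eq_bigr => p _; rewrite linearZ /= mxinnerC.
Qed.

Lemma dual_slack_sym (y : 'cV[R]_m) : dual_slack Q y \is symmetricmx.
Proof.
have Q_symE p i j : Q p i j = Q p j i by have /symmetricmxP := Q_sym p.
apply/symmetricmxP => i j; rewrite !mxE !summxE Q_symE; congr (_ + _).
by apply: eq_bigr => p _; rewrite !mxE Q_symE.
Qed.

Lemma dual_objE (y : 'cV[R]_m) : (b^T *m y) 0 0 = \sum_p b p 0 * y p 0.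
Proof. by rewrite mxE; apply: eq_bigr => p _; rewrite mxE. Qed.

(** With a gap, no primal feasible matrix has value at most [mid]; the Farkas multipliers of this
    system, scaled, are a dual feasible point with value above [mid]. *)
Lemma no_gap_bounded_primal (X : 'M[R]_n) (y : 'cV[R]_m) :
  sdp_optimal Q b X -> dual_optimal Q b y -> bounded_set (sdp_feasible Q b) ->
  mxinner (Q ord0) X <= - (b^T *m y) 0 0.
Proof.
move=> [[X_le X_psd] X_min] [y_feas y_max] F_bounded.
rewrite leNgt; apply/negP => gap.
pose mid := (mxinner (Q ord0) X + - (b^T *m y) 0 0) / 2.
pose K := [set u : 'rV[R]_(n * n) | psdmx (vec_mx u)].
(* The objective joins the constraints at index [ord0], with bound [mid]. *)
pose beta i := oapp (fun p => b p 0) mid (unlift ord0 i).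
have [||||||lam [lam_ge0 lamK lam_beta]] := @cone_farkas R _ 'I_m.+1 K
    (fun i u => mxinner (Q i) (vec_mx u)) beta 
    (closed_psdmx_linear _ _ _ _ (@linearP _ _ _ _ vec_mx)).
- by rewrite /K /= linear0; exact: psdmx0.
- by move=> u v Ku Kv; rewrite /K /= linearD; exact: psdmxD.
- by move=> s u s_ge0 Ku; rewrite /K /= linearZ; exact: psdmxZ.
- by move=> i a u v; rewrite /= !linearP.
(* Such a [u] is a recession direction of the bounded primal feasible set. *)
- move=> u Ku Qu_le0; apply: (can_inj (@vec_mxK _ _ _)); rewrite linear0.
  apply: (bounded_ray _ _ _ X _ F_bounded) => s s_ge0; split; last first.
    exact/psdmxD/psdmxZ.
  move=> p; rewrite linearD linearZ /=.
  have := X_le p; have := Qu_le0 (lift ord0 p); nra.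
- move=> [u Ku Qu_le].
  have : sdp_feasible Q b (vec_mx u).
    by split=> // p; have := Qu_le (lift ord0 p); rewrite /beta liftK.
  move=> /X_min; have := Qu_le ord0; rewrite /beta unlift_none /= /mid; lra.
have {}lamK Z : psdmx Z -> 0 <= lam ord0 * mxinner (Q ord0) Z
    + \sum_p lam (lift ord0 p) * mxinner (Q (lift ord0 p)) Z.
  move=> Z_psd; have := lamK (mxvec Z); rewrite /K /= mxvecK big_ord_recl.
  exact.
move: lam_beta; rewrite big_ord_recl {1}/beta unlift_none /=.
under eq_bigr do rewrite /beta liftK /=.
(* A zero multiplier on the objective would certify primal infeasibility, against [X]. *)
have := lam_ge0 ord0; rewrite le_eqVlt => /predU1P[t0|t_gt0].
  rewrite -t0 mul0r add0r ltNge => /negP; apply.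
  have := lamK X X_psd; rewrite -t0 mul0r add0r => /le_trans; apply.
  by apply: ler_sum => p _; exact: ler_wpM2l.
move=> lam_beta; pose z := \col_p (lam (lift ord0 p) / lam ord0).
have z_feas : dual_feasible Q z.
  split=> [p|]; first by rewrite mxE divr_ge0.
  split=> [|x]; first exact: dual_slack_sym.
  rewrite -mxinner_outer mxinner_dual_slack -(pmulr_rge0 _ t_gt0) mulrDr
    [X in _ + X]mulr_sumr.
  apply: le_trans (lamK _ (psdmx_outer _ _ x)) _; rewrite lerD2l.
  apply: ler_sum => p _.
  by rewrite mxE mulrA [lam ord0 * _]mulrC divfK ?gt_eqF.
have := y_max z z_feas; rewrite dual_objE.
suff : lam ord0 * mid < lam ord0 * - \sum_p b p 0 * z p 0.
  by rewrite ltr_pM2l // /mid dual_objE; move: gap; rewrite dual_objE; lra.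
rewrite mulrN mulr_sumr -subr_lt0 opprK.
apply: le_lt_trans lam_beta; rewrite lerD2l; apply: ler_sum => p _.
by rewrite mxE [b p 0 * _]mulrC mulrA [lam ord0 * _]mulrC divfK ?gt_eqF.
Qed.

(** With a gap, no dual feasible point has value at least [mid]; the Farkas multipliers of this
    system yield a primal matrix [V] that contradicts the optimality of [X]. *)
Lemma no_gap_bounded_dual (X : 'M[R]_n) (y : 'cV[R]_m) :
  sdp_optimal Q b X -> dual_optimal Q b y -> bounded_set (dual_optimal Q b) ->
  mxinner (Q ord0) X <= - (b^T *m y) 0 0.
Proof.
move=> [[X_le X_psd] X_min] [[y_ge0 [_ Sy_ge0]] y_max] F_bounded.
rewrite leNgt; apply/negP => gap.
pose mid := (mxinner (Q ord0) X + - (b^T *m y) 0 0) / 2.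
(* A row vector encodes a pair (y, Z) with y >= 0 and Z psd. The equation S(y) = Z, that is
   [D u = - Q ord0], is split into two inequalities per entry. *)
pose yv (u : 'rV[R]_(m + n * n)) : 'cV[R]_m := (lsubmx u)^T.
pose Zm (u : 'rV[R]_(m + n * n)) : 'M[R]_n := vec_mx (rsubmx u).
pose K := [set u | nonneg_vec (yv u) /\ psdmx (Zm u)].
pose D (u : 'rV[R]_(m + n * n)) :=
  \sum_p yv u p 0 *: Q (lift ord0 p) - Zm u.
pose I := ('I_1 + ('I_n * 'I_n + 'I_n * 'I_n))%type.
pose l (i : I) u := match i with
  | inl _ => (b^T *m yv u) 0 0
  | inr (inl ij) => D u ij.1 ij.2
  | inr (inr ij) => - D u ij.1 ij.2 end.
pose beta (i : I) := match i with
  | inl _ => - mid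
  | inr (inl ij) => - Q ord0 ij.1 ij.2
  | inr (inr ij) => Q ord0 ij.1 ij.2 end.
have yvP a u v : yv (a *: u + v) = a *: yv u + yv v.
  by rewrite /yv !linearP.
have ZmP a u v : Zm (a *: u + v) = a *: Zm u + Zm v.
  by rewrite /Zm !linearP.
have DP a u v : D (a *: u + v) = a *: D u + D v.
  rewrite /D yvP ZmP scalerBr addrACA -opprD scaler_sumr -big_split.
  congr (_ - _); apply: eq_bigr => p _ /=.
  by rewrite !mxE scalerDl scalerA.
have yv0 : yv 0 = 0 by rewrite /yv !linear0.
have Zm0 : Zm 0 = 0 by rewrite /Zm !linear0.
have D_le0 u : (forall i j, D u i j <= 0) -> (forall i j, - D u i j <= 0) ->
    D u = 0.
  move=> D_le D_ge; apply/matrixP => i j; rewrite [RHS]mxE.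
  by have := D_le i j; have := D_ge i j; lra.
have [|||||||lam [lam_ge0 lamK lam_beta]] := @cone_farkas R _ I K l beta.
- apply: (@closedI _ [set u | nonneg_vec (yv u)] [set u | psdmx (Zm u)]).
    rewrite (_ : mkset _ = \bigcap_(p in [set: 'I_m]) [set u | 0 <= yv u p 0]).
      apply: closed_bigI => p _; apply: closed_scalar_ge0 => a u v.
      by rewrite yvP !mxE.
    by apply/seteqP; split=> u /= yu p => [_|]; exact: yu.
  exact: closed_psdmx_linear.
- split; first by move=> p; rewrite yv0 mxE.
  by rewrite Zm0; exact: psdmx0.
- move=> u v [yu Zu] [yv' Zv]; split.
    by move=> p; rewrite -[u]scale1r yvP scale1r mxE addr_ge0.
  by rewrite -[u]scale1r ZmP scale1r; exact: psdmxD.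
- move=> s u s_ge0 [yu Zu]; split.
    by move=> p; rewrite -[_ *: _]addr0 yvP yv0 addr0 mxE mulr_ge0.
  by rewrite -[_ *: _]addr0 ZmP Zm0 addr0; exact: psdmxZ.
- move=> [i|[[i j]|[i j]]] a u v /=; rewrite ?yvP ?DP.
  + by rewrite linearP !mxE.
  + by rewrite !mxE.
  + by rewrite !mxE; ring.
- move=> u [yu Zu] l_le0.
  have Du0 : D u = 0.
    by apply: D_le0 => i j; [exact: (l_le0 (inr (inl (i, j))))
                            | exact: (l_le0 (inr (inr (i, j))))].
  have yu0 : yv u = 0.
    (* Along [yv u] the slack gains the psd matrix [s *: Zm u] and the objective does not decrease,
       so the whole ray from [y] is dual optimal. *)
    apply: (bounded_ray _ _ _ y _ F_bounded) => s s_ge0.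
    have slackE : dual_slack Q (y + s *: yv u) = dual_slack Q y + s *: Zm u.
      rewrite /dual_slack -addrA; congr (_ + _).
      have -> : Zm u = \sum_p yv u p 0 *: Q (lift ord0 p).
        by apply/esym/eqP; rewrite -subr_eq0; apply/eqP.
      rewrite scaler_sumr -big_split; apply: eq_bigr => p _ /=.
      by rewrite !mxE scalerDl scalerA.
    split; first split.
    + by move=> p; rewrite mxE [X in _ + X]mxE addr_ge0 // mulr_ge0.
    + by rewrite slackE; apply: psdmxD; [split => //; exact: dual_slack_sym
                                        | exact: psdmxZ].
    + move=> z /y_max /le_trans; apply.
      rewrite linearD linearZ /= !mxE lerN2 gerDl.
      by have := l_le0 (inl ord0); rewrite /= mxE; nra.
  have Zu0 : Zm u = 0.
    move: Du0; rewrite /D yu0 big1 => [|p _]; last by rewrite mxE scale0r.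
    by rewrite sub0r => /eqP; rewrite oppr_eq0 => /eqP.
  rewrite -[u]hsubmxK -[rsubmx u]vec_mxK -/(Zm u) Zu0 linear0.
  by rewrite -[lsubmx u]trmxK -/(yv u) yu0 linear0 row_mx0.
- move=> [u [yu Zu] l_le].
  have slackE : dual_slack Q (yv u) = Zm u.
    apply/matrixP => i j.
    have := l_le (inr (inl (i, j))); have := l_le (inr (inr (i, j))).
    by rewrite /= /dual_slack /D !mxE; lra.
  have : dual_feasible Q (yv u) by split => //; rewrite slackE.
  by move=> /y_max; have := l_le (inl ord0); rewrite /= /mid; lra.
pose t := lam (inl ord0).
(* Differences of the paired multipliers: the sign-free multiplier of S(y) = Z. *)
pose W := \matrix_(i, j) (lam (inr (inl (i, j))) - lam (inr (inr (i, j)))).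
have lamE (c : R) (A : 'M[R]_n) : \sum_i lam i * (match i with
    | inl _ => c | inr (inl ij) => A ij.1 ij.2 
    | inr (inr ij) => - A ij.1 ij.2 end) = t * c + mxinner W A.
  rewrite !big_sumType /= big_ord1 /mxinner pair_bigA -big_split /=.
  congr (_ + _); apply: eq_bigr => -[i j] _; rewrite !mxE /=; ring.
have {}lamK z Z : nonneg_vec z -> psdmx Z ->
    0 <= t * (b^T *m z) 0 0
      + mxinner W (\sum_p z p 0 *: Q (lift ord0 p) - Z).
  move=> z_ge0 Z_psd; have := lamK (row_mx z^T (mxvec Z)).
  rewrite lamE /K /D /Zm /yv /= row_mxKl row_mxKr trmxK mxvecK; exact.
have {}lam_beta : 0 < t * mid + mxinner W (Q ord0).
  rewrite -oppr_lt0; apply: le_lt_trans lam_beta.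
  have -> : \sum_i lam i * beta i = t * - mid + mxinner W (- Q ord0).
    rewrite -lamE; apply: eq_bigr => -[i|[ij|ij]] _ //=; by rewrite !mxE ?opprK.
  by rewrite linearN mulrN opprD.
(* [W] may fail to be symmetric; passing to its symmetric part preserves inner products with
   symmetric matrices. *)
pose V := - (2^-1 *: (W + W^T)).
have VE A : A \is symmetricmx -> mxinner A V = - mxinner W A.
  move=> A_sym; rewrite linearN linearZ linearD /= mxinner_trmxr // mxinnerC.
  lra.
have V_psd : psdmx V.
  split=> [|x]; first by apply/symmetricmxP => i j; rewrite !mxE addrC.
  have := lamK 0 (x *m x^T); rewrite mulmx0 mxE mulr0 add0r big1 => [|p _]; last first.
    by rewrite mxE scale0r.
  rewrite sub0r linearN -mxinner_outer mxinnerC VE; last by case: (psdmx_outer _ _ x).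
  by apply => [p|]; [rewrite mxE | exact: psdmx_outer].
have QV_le p : mxinner (Q (lift ord0 p)) V <= t * b p 0.
  rewrite VE //.
  have := lamK (delta_mx p 0) 0; rewrite subr0 (bigD1 p) //= big1 => [|q qp].
    rewrite -colE !mxE !eqxx scale1r addr0 => lam_ge.
    rewrite lerNl -subr_ge0 opprK addrC; apply: lam_ge => [q|].
      by rewrite mxE ler0n.
    exact: psdmx0.
  by rewrite mxE (negbTE qp) scale0r.
have QV_lt : mxinner (Q ord0) V < t * mid by rewrite VE //; lra.
(* If [t] is 0, [V] is a primal recession direction that lowers the objective, and [X + V] beats
   [X]. Otherwise [t^-1 *: V] is feasible with value below [mid]. *)
have := lam_ge0 (inl ord0); rewrite -/t le_eqVlt => /predU1P[t0|t_gt0].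
  have : sdp_feasible Q b (X + V).
    split; last exact: psdmxD.
    move=> p; rewrite linearD /=; have := X_le p; have := QV_le p.
    by rewrite -t0; lra.
  by move=> /X_min; rewrite linearD /=; move: QV_lt; rewrite -t0; lra.
have : sdp_feasible Q b (t^-1 *: V).
  split; last by apply: psdmxZ => //; rewrite invr_ge0 ltW.
  by move=> p; rewrite linearZ /= mulrC ler_pdivrMr // mulrC.
move=> /X_min; rewrite linearZ /= mulrC ler_pdivlMr //.
move: QV_lt; rewrite [t * mid]mulrC => QV_lt XV.
have := le_lt_trans XV QV_lt; rewrite ltr_pM2r // /mid; lra.
Qed.

End Duality.

(** * Assembly of the rank-one optimal solution *)

Theorem theorem3p5 (R : realType) (n m : nat)
    (Q : 'I_m.+1 -> 'M[R]_n) (b : 'cV[R]_m)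
    (Q_sym : forall p, Q p \is symmetricmx)
    (P_feasible : qcqp_feasible Q b !=set0)
    (hA : assumptionA Q b)
    (G_bipartite : bipartite (sparsity_graph Q))
    (G_connected : graph_connected (sparsity_graph Q))
    (hS : forall k l : 'I_n, sparsity_graph Q k l ->
      ~ exists y : 'cV[R]_m,
          [/\ nonneg_vec y, psdmx (dual_slack Q y) & dual_slack Q y k l <= 0]) :
  sdp_exact Q b.
Proof.
case: hA => [[[X X_opt] [y y_opt]] F_bounded].
have no_gap : mxinner (Q ord0) X <= - (b^T *m y) 0 0.
  by case: F_bounded; [exact: no_gap_bounded_primal | exact: no_gap_bounded_dual].
have [[y_ge0 Sy_psd] _] := y_opt; have [[X_le X_psd] X_min] := X_opt.
have SX_le0 : mxinner (dual_slack Q y) X <= 0.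
  rewrite mxinner_dual_slack; move: no_gap; rewrite dual_objE => no_gap.
  apply: le_trans (lerD no_gap (lexx _)) _.
  rewrite addrC subr_le0; apply: ler_sum => p _.
  by rewrite [leRHS]mulrC; exact: ler_wpM2l.
have [U eU] := G_bipartite.
have Q0 i j p : i != j -> ~~ sparsity_graph Q i j -> Q p i j = 0.
  move=> ij; rewrite /sparsity_graph ij /= => /existsPn /(_ p).
  by rewrite negbK => /eqP.
have [|i j ij eij|v vE] := bipartite_rank_one _ _ (sparsity_graph Q) U _ _
    Sy_psd X_psd SX_le0 eU.
(* A nonpositive edge entry of the slack would make [y] a point excluded by condition (2). *)
- move=> i j eij; rewrite ltNge; apply/negP => S_le0.
  by apply: (hS i j eij); exists y.
- rewrite /dual_slack mxE summxE Q0 // big1 ?addr0 // => p _.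
  by rewrite mxE Q0 // mulr0.
(* Every [Q p] vanishes off the diagonal and the edges, where [v *m v^T] and [X] may differ. *)
have QvE p : mxinner (Q p) (v *m v^T) = mxinner (Q p) X.
  apply: eq_bigr => i _; apply: eq_bigr => j _.
  rewrite !mxE big_ord1 mxE.
  have [/vE -> //|] := boolP ((i == j) || sparsity_graph Q i j).
  by rewrite negb_or => /andP[ij eij]; rewrite Q0 // !mul0r.
exists (v *m v^T); split; last first.
  by apply: leq_trans (mxrankM_maxl _ _) _; exact: rank_leq_col.
split; last by move=> Z Z_feas; rewrite QvE; exact: X_min.
by split; [move=> p; rewrite QvE | exact: psdmx_outer].
Qed.
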